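(* Let $S$ be a gap absorbing submonoid of $\mathbb{N}^2$. Then the catenary degree of $S$ is at most three, that is, $\mathsf{c}(S)\le 3$.
   Context: $\mathbb{N}$ is the set of non-negative integers and $\mathbb{N}^2$ is the additive monoid with componentwise addition; $\mathbf{0}=(0,0)$. For $X,Y\subseteq\mathbb{N}^2$, $X+Y=\{x+y:x\in X,\ y\in Y\}$ and $2X=X+X$. For a submonoid $S$ of $\mathbb{N}^2$: $S^*=S\setminus\{\mathbf{0}\}$; $\mathcal{H}(S)=\mathbb{N}^2\setminus S$ is the set of gaps; $\mathcal{A}(S)=S^*\setminus(S^*+S^* )$ is the set of atoms. $S$ is gap absorbing if $2\mathcal{H}(S)\subseteq\mathcal{H}(S)\cup\mathcal{A}(S)\cup 2\mathcal{A}(S)$ and $\mathcal{H}(S)+\mathcal{A}(S)\subseteq\mathcal{A}(S)\cup 2\mathcal{A}(S)$. For $\mathbf{s}\in S$, the set of factorizations of $\mathbf{s}$ is $\mathsf{Z}(\mathbf{s})=\{(\lambda_{\mathbf{a}})_{\mathbf{a}\in\mathcal{A}(S)}\in\mathbb{N}^{(\mathcal{A}(S))}:\sum_{\mathbf{a}}\lambda_{\mathbf{a}}\mathbf{a}=\mathbf{s}\}$, where $\mathbb{N}^{(\mathcal{A}(S))}$ denotes finitely supported families of non-negative integers. For $\mathbf{u}=(\lambda_{\mathbf{a}})$, $\mathbf{v}=(\mu_{\mathbf{a}})$ in $\mathbb{N}^{(\mathcal{A}(S))}$, put $|\mathbf{u}|=\sum_{\mathbf{a}}\lambda_{\mathbf{a}}$,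 let $\mathbf{u}\wedge\mathbf{v}=(\min(\lambda_{\mathbf{a}},\mu_{\mathbf{a}}))_{\mathbf{a}}$, and $\operatorname{d}(\mathbf{u},\mathbf{v})=\max\{|\mathbf{u}-(\mathbf{u}\wedge\mathbf{v})|,|\mathbf{v}-(\mathbf{u}\wedge\mathbf{v})|\}$. For $\mathbf{u},\mathbf{v}\in\mathsf{Z}(\mathbf{s})$, an $N$-chain joining them is a sequence $\mathbf{u}_1=\mathbf{u},\dots,\mathbf{u}_n=\mathbf{v}$ in $\mathsf{Z}(\mathbf{s})$ with $\operatorname{d}(\mathbf{u}_i,\mathbf{u}_{i+1})\le N$ for all $i\in\{1,\dots,n-1\}$. The catenary degree $\mathsf{c}(\mathbf{s})$ is the minimum positive integer $N$ such that any two factorizations of $\mathbf{s}$ are joined by an $N$-chain, and $\mathsf{c}(S)=\sup\{\mathsf{c}(\mathbf{s}):\mathbf{s}\in S\}$. *)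

(* Defs.v *)
From HB Require Import structures.
From mathcomp Require Import all_boot all_order all_algebra.
From mathcomp Require Import finmap multiset.
From mathcomp Require Import all_classical all_reals all_analysis.

Set Implicit Arguments.
Unset Strict Implicit.
Unset Printing Implicit Defensive.

Import Order.TTheory GRing.Theory Num.Theory.

Local Open Scope classical_set_scope.
Local Open Scope ring_scope.

(* N^2 with the componentwise addition of the product nmodType. *)
Notation N2 := (nat * nat)%type.

Definition submonoid (S : set N2) : Prop :=
  S 0 /\ (forall x y, S x -> S y -> S (x + y)).

Definition sumset (X Y : set N2) : set N2 := [set x + y | x in X & y in Y].

Definition nonzero (S : set N2) : set N2 := S `\ 0.

Definition gaps (S : set N2) : set N2 := ~` S.

Definition atoms (S : set N2) : set N2 :=
  nonzero S `\` sumset (nonzero S) (nonzero S).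

Definition gap_absorbing (S : set N2) : Prop :=
  sumset (gaps S) (gaps S) `<=`
    gaps S `|` atoms S `|` sumset (atoms S) (atoms S) /\
  sumset (gaps S) (atoms S) `<=` atoms S `|` sumset (atoms S) (atoms S).

(* A finitely supported family of non-negative integers indexed by a set A is
   a multiset over N2, i.e. a finitely supported function N2 -> nat, whose
   support is contained in A. *)
Definition family_on (A : set N2) (u : {mset N2}%mset) : Prop :=
  forall a, a \in finsupp u -> A a.

Definition mlength (u : {mset N2}%mset) : nat := (\sum_(a <- finsupp u) u a)%N.

Definition mvalue (u : {mset N2}%mset) : N2 := \sum_(a <- finsupp u) a *+ u a.

Definition factorizations (S : set N2) (s : N2) : set {mset N2}%mset :=
  [set u | family_on (atoms S) u /\ mvalue u = s].

(* msetI is the pointwise minimum; msetB is the pointwise truncated difference,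
   which is exact here because u /\ v is below both u and v. *)
Definition mdist (u v : {mset N2}%mset) : nat :=
  maxn (mlength (msetB u (msetI u v))) (mlength (msetB v (msetI u v))).

(* The chain is the nonempty sequence u :: p, from u to last u p = v. *)
Definition chain_joined (S : set N2) (s : N2) (N : nat)
    (u v : {mset N2}%mset) : Prop :=
  exists p : seq {mset N2}%mset,
    [/\ forall w, w \in u :: p -> factorizations S s w,
        path (fun x y => (mdist x y <= N)%N) u p
      & last u p = v].

Definition chain_bound (S : set N2) (s : N2) (N : nat) : Prop :=
  (0 < N)%N /\
  forall u v, factorizations S s u -> factorizations S s v ->
    chain_joined S s N u v.

Lemma mlength_le_mvalue (S : set N2) (u : {mset N2}%mset) :
  family_on (atoms S) u ->
  (mlength u <= (mvalue u).1 + (mvalue u).2)%N.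
Proof.
move=> uA; rewrite /mlength /mvalue.
suff H (r : seq N2) : {subset r <= finsupp u} ->
    (\sum_(a <- r) u a <=
     (\sum_(a <- r) a *+ u a)%R.1 + (\sum_(a <- r) a *+ u a)%R.2)%N.
  exact: H.
elim: r => [|a r IH] sub; first by rewrite !big_nil.
rewrite !big_cons.
have {}IH : (\sum_(a <- r) u a <=
     (\sum_(a <- r) a *+ u a)%R.1 + (\sum_(a <- r) a *+ u a)%R.2)%N.
  by apply: IH => b br; apply: sub; rewrite inE br orbT.
have [[_ /eqP a0] _] := uA a (sub a (mem_head _ _)).
rewrite [X in (_ <= X)%N](_ : _ =
  (((a *+ u a).1 + (a *+ u a).2) + ((\sum_(a <- r) a *+ u a)%R.1 +
    (\sum_(a <- r) a *+ u a)%R.2))%N); last by rewrite addnACA.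
apply: leq_add => //.
have -> n : ((a *+ n).1 + (a *+ n).2 = n * (a.1 + a.2))%N.
  elim: n => [//|n IHn]; rewrite mulrS mulSn -IHn.
  by rewrite addnACA.
rewrite leq_pmulr // lt0n addn_eq0.
by apply: contraNN a0; case: a {sub} => a b /= /andP[/eqP-> /eqP->].
Qed.

Lemma mlength_msetB (u w : {mset N2}%mset) :
  (mlength (msetB u w) <= mlength u)%N.
Proof.
rewrite /mlength.
have sub : {subset finsupp (msetB u w) <= finsupp u}.
  by move=> a; rewrite !mem_finsupp msetE2; case: (u a).
rewrite [leqRHS](big_fsetID _ (mem (finsupp (msetB u w)))) /=.
apply: leq_trans (leq_addr _ _).
rewrite [leqRHS](_ : _ = (\sum_(a <- finsupp (msetB u w)) u a)%N).
  by apply: leq_sum => a _; rewrite msetE2 leq_subr.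
congr bigop; congr (enum_fset _); apply/fsetP => a.
by rewrite !inE /= andb_idl // => /sub.
Qed.

Lemma chain_bound_ex (S : set N2) (s : N2) :
  exists N, `[< chain_bound S s N >].
Proof.
exists (s.1 + s.2).+1; apply/asboolP; split=> // u v [uA us] [vA vs].
exists [:: v]; split=> //=.
- by move=> w; rewrite !inE => /orP[] /eqP->.
- rewrite andbT geq_max; apply/andP; split; apply: leqW.
  + rewrite -us; apply: leq_trans (mlength_le_mvalue uA).
    exact: mlength_msetB.
  + rewrite -vs; apply: leq_trans (mlength_le_mvalue vA).
    exact: mlength_msetB.
Qed.

Definition catenary_degree_elt (S : set N2) (s : N2) : nat :=
  ex_minn (chain_bound_ex S s).

(* The supremum is taken in \bar R, so that an unbounded family has degree
   +oo. *)
Definition catenary_degree (R : realType) (S : set N2) : \bar R :=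
  ereal_sup [set ((catenary_degree_elt S s)%:R)%:E | s in S].

(* Main.v *)
(** Absorption of H(S) by the atoms makes S^* an up-set of N^2.  Argue by
induction on s; factorizations sharing an atom are joined by the induction
hypothesis, and those of length at most 3 are at distance at most 3.

If a occurs in u, b in v and s = a + b + h, then u and v are joined: either h
is in S, and a + b + (a factorization of h) meets both, or h is a gap, and
b + (h + a), a + (h + b) give factorizations of length at most 3 meeting v and
u respectively.

If u has length at least 3, some atom a of u satisfies 2a <= s.  When v also
has length at least 3 it contains such a b, so a + b <= s.  The remaining case
is s = b + b' with a + b, a + b' not below s; up to exchange, b = (a_1, 0) + g
and b' = (0, a_2) + g', so s = a + g + g'.  If g and g' are gaps then
g + g' = s - a has a factorization of length at most 2.  If g is in S^*, it is
an atom, and g + (b - g + b') gives a factorization of length at most 3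
containing g, while a + g <= s; symmetrically for g'. *)

From Pilot Require Import Defs.
From mathcomp Require Import all_boot all_order all_algebra.
From mathcomp Require Import finmap multiset zify.
From mathcomp Require Import all_classical all_reals all_analysis.

Set Implicit Arguments.
Unset Strict Implicit.
Unset Printing Implicit Defensive.

Import Pilot.Defs.
Import Order.TTheory GRing.Theory Num.Theory.

Local Open Scope classical_set_scope.
Local Open Scope ring_scope.

(** * The size of a point of [N2]; multisets of points with their length, value and distance *)

Definition size_N2 (x : N2) : nat := (x.1 + x.2)%N.

Lemma size_N2D (x y : N2) : size_N2 (x + y) = (size_N2 x + size_N2 y)%N.
Proof. exact: addnACA. Qed.

Lemma size_N2_gt0 (x : N2) : x <> 0 -> (0 < size_N2 x)%N.
Proof.
rewrite lt0n addn_eq0 => x0; apply/negP => /andP[/eqP x1 /eqP x2].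
by apply: x0; case: x x1 x2 => /= ? ? -> ->.
Qed.

Lemma N2_le_add (x y : N2) :
  (x.1 <= y.1)%N -> (x.2 <= y.2)%N -> exists z : N2, y = x + z.
Proof.
move=> le1 le2; exists (y.1 - x.1, y.2 - x.2)%N.
case: x y le1 le2 => [x1 x2] [y1 y2] /= le1 le2.
by congr pair; apply/esym/subnKC.
Qed.

Lemma N2_addI (x : N2) : injective (+%R x).
Proof.
case: x => [x1 x2] [y1 y2] [z1 z2] [/addnI E1 /addnI E2].
by congr pair.
Qed.

Lemma mlengthE (u : {mset N2}%mset) : mlength u = size u.
Proof. by rewrite size_mset. Qed.

Lemma mlength_mset0 : mlength (mset0 : {mset N2}%mset) = 0%N.
Proof. by rewrite mlengthE size_mset0. Qed.

Lemma mset_consE (a : N2) (u : {mset N2}%mset) :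
  (a +` u)%mset = seq_mset (a :: u).
Proof. by rewrite mset_cons seq_mset_id. Qed.

Lemma mlength_cons (a : N2) (u : {mset N2}%mset) :
  mlength (a +` u)%mset = (mlength u).+1.
Proof. by rewrite !mlengthE mset_consE (perm_size (perm_eq_seq_mset _)). Qed.

Lemma mvalueE (u : {mset N2}%mset) : mvalue u = \sum_(a <- u) a.
Proof.
rewrite /mvalue big_mset /=.
exact: eq_bigr.
Qed.

Lemma mvalue_mset0 : mvalue mset0 = 0.
Proof. by rewrite mvalueE big_mset0. Qed.

Lemma mvalue_cons (a : N2) (u : {mset N2}%mset) :
  mvalue (a +` u)%mset = a + mvalue u.
Proof. by rewrite !mvalueE mset_consE (perm_big _ (perm_eq_seq_mset _)) big_cons. Qed.

Lemma mvalueD (u v : {mset N2}%mset) :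
  mvalue (u `+` v)%mset = mvalue u + mvalue v.
Proof.
rewrite -[u in LHS]seq_mset_id [mvalue u]mvalueE.
elim: (enum_mset u) => [|a l IHl].
  rewrite big_nil add0r; congr mvalue.
  by apply/msetP => a; rewrite msetE2 mset_seqE.
by rewrite mset_cons -msetDA mvalue_cons IHl big_cons addrA.
Qed.

Lemma mdistC (u v : {mset N2}%mset) : mdist u v = mdist v u.
Proof. by rewrite /mdist maxnC msetIC. Qed.

(** Meet and difference both commute with adjoining [a], so this operation is an isometry and chains
    can be translated by an atom. *)
Lemma mdist_cons (a : N2) (u v : {mset N2}%mset) :
  mdist (a +` u)%mset (a +` v)%mset = mdist u v.
Proof. by rewrite /mdist -msetDIr !msetBDl. Qed.

Lemma mdist_le_mlength (u v : {mset N2}%mset) :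
  (mdist u v <= maxn (mlength u) (mlength v))%N.
Proof.
by rewrite geq_max !leq_max !mlength_msetB ?orbT.
Qed.

(** * Building and splitting factorizations *)

Lemma factorizations_cons (S : set N2) (s a : N2) (u : {mset N2}%mset) :
  atoms S a -> factorizations S s u -> factorizations S (a + s) (a +` u)%mset.
Proof.
move=> Aa [uA us]; split; last by rewrite mvalue_cons us.
by move=> b; rewrite msuppE in_mset1D => /orP[/eqP -> //|]; rewrite -msuppE; exact: uA.
Qed.

Lemma factorizations_uncons (S : set N2) (s a : N2) (u : {mset N2}%mset) :
  factorizations S s (a +` u)%mset ->
  exists t : N2, [/\ atoms S a, s = a + t & factorizations S t u].
Proof.
move=> [uA us]; exists (mvalue u); split; last split => //.
- by apply: uA; rewrite msuppE mset1D1.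
- by rewrite -us mvalue_cons.
- by move=> b bu; apply: uA; rewrite msuppE mset1Dr // -msuppE.
Qed.

Lemma mlength_gt0P (u : {mset N2}%mset) :
  (0 < mlength u)%N -> exists (a : N2) (u' : {mset N2}%mset), u = (a +` u')%mset.
Proof.
case: (mset_0Vmem u) => [->|[a au] _]; first by rewrite mlength_mset0.
by exists a, (u `\ a)%mset; rewrite msetB1K.
Qed.

Lemma mset0_factorization (S : set N2) : factorizations S 0 mset0.
Proof. by split; [move=> a; rewrite msuppE in_mset0 | exact: mvalue_mset0]. Qed.

(** Turns the right-hand sides of the two absorption conditions into factorizations; adjoining one
    more atom then keeps the length within 3. *)
Lemma short_factorization (S : set N2) (s : N2) :
  (atoms S `|` sumset (atoms S) (atoms S)) s ->
  exists2 u, factorizations S s u & (mlength u <= 2)%N.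
Proof.
case=> [As|[a Aa [b Ab <-]]].
  exists (s +` mset0)%mset; last by rewrite mlength_cons mlength_mset0.
  by rewrite -[s in X in X _](addr0 s); apply: factorizations_cons (mset0_factorization S).
exists (a +` (b +` mset0))%mset; last by rewrite !mlength_cons mlength_mset0.
rewrite -[a + b]addr0 -addrA; do 2![apply: factorizations_cons => //].
exact: mset0_factorization.
Qed.

Lemma atoms_sub (S : set N2) (a : N2) : atoms S a -> S a.
Proof. by move=> [[]]. Qed.

(** A nonzero element that is not an atom splits into two nonzero elements of strictly smaller size,
    so induction on the size applies. *)
Lemma factorization_ex (S : set N2) (s : N2) : S s -> exists u, factorizations S s u.
Proof.
suff H n : forall x, (size_N2 x < n)%N -> S x -> exists u, factorizations S x u.
  exact: H (ltnSn _).
elim: n => // n IH x xn Sx.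
have [->|/eqP x0] := eqVneq x 0; first by exists mset0; exact: mset0_factorization.
have [|nA] := pselect (atoms S x).
  by move=> Ax; case: (@short_factorization S x (or_introl Ax)) => u; exists u.
have [[y [Sy /= y0] [z [Sz /= z0] yz]]|nS] :=
    pselect (sumset (nonzero S) (nonzero S) x); last by case: nA; split.
have [] := (size_N2_gt0 y0, size_N2_gt0 z0).
move: xn; rewrite -yz size_N2D => xn y1 z1.
have [u [uA us]] : exists u, factorizations S y u by apply: IH => //; lia.
have [v [vA vs]] : exists v, factorizations S z v by apply: IH => //; lia.
exists (u `+` v)%mset; split; last by rewrite mvalueD us vs.
by move=> a; rewrite msuppE in_msetD -!msuppE => /orP[/uA|/vA].
Qed.

(** * Being joined by an [N]-chain: closure properties and translation by an atom *)

Section ChainEquivalence.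
Variables (S : set N2) (s : N2) (N : nat).

Lemma chain_joined_step u v : factorizations S s u -> factorizations S s v ->
  (mdist u v <= N)%N -> chain_joined S s N u v.
Proof.
move=> uS vS d; exists [:: v]; split; rewrite /= ?d //.
by move=> w; rewrite !inE => /orP[] /eqP ->.
Qed.

Lemma chain_joined_trans u v w :
  chain_joined S s N u v -> chain_joined S s N v w -> chain_joined S s N u w.
Proof.
move=> [p [pS pp pl]] [q [qS qp ql]]; exists (p ++ q); split.
- move=> x; rewrite -cat_cons mem_cat => /orP[/pS //|xq].
  by apply: qS; rewrite inE xq orbT.
- by rewrite cat_path pp pl.
- by rewrite last_cat pl.
Qed.

Lemma chain_joined_sym u v : chain_joined S s N u v -> chain_joined S s N v u.
Proof.
move=> [p]; elim: p u => [|w p IH] u [pS /= pp pl].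
  by exists [::]; split=> //=; rewrite -pl.
case/andP: pp => uw pp.
have pS' x : x \in w :: p -> factorizations S s x.
  by move=> xp; apply: pS; rewrite inE xp orbT.
apply: (@chain_joined_trans v w u); first by apply: IH; split.
apply: chain_joined_step; last by rewrite mdistC.
- by apply: pS'; rewrite mem_head.
- by apply: pS; rewrite mem_head.
Qed.

Lemma chain_joined_short u v : factorizations S s u -> factorizations S s v ->
  (mlength u <= N)%N -> (mlength v <= N)%N -> chain_joined S s N u v.
Proof.
move=> uS vS ul vl; apply: chain_joined_step => //.
by apply: leq_trans (mdist_le_mlength u v) _; rewrite geq_max ul.
Qed.

Lemma chain_joined_cons a u v : atoms S a -> chain_joined S s N u v ->
  chain_joined S (a + s) N (a +` u)%mset (a +` v)%mset.
Proof.
move=> Aa [p [pS pp pl]]; exists [seq a +` x | x <- p]%mset; split.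
- move=> x; rewrite -(map_cons (fun x => a +` x)%mset) => /mapP[y /pS yS ->].
  exact: factorizations_cons.
- by rewrite path_map; apply: sub_path pp => x y /=; rewrite mdist_cons.
- by rewrite last_map pl.
Qed.

End ChainEquivalence.

(** * Consequences of absorption: up-set property, summands of atoms *)

Section GapAbsorbing.
Variable S : set N2.
Hypotheses (hS : submonoid S) (hgap : gap_absorbing S).

Lemma gap_add_atom h a : ~ S h -> atoms S a ->
  (atoms S `|` sumset (atoms S) (atoms S)) (h + a).
Proof. by move=> Sh Aa; apply: hgap.2; exists h => //; exists a. Qed.

Lemma gap_add_gap h k : ~ S h -> ~ S k -> S (h + k) ->
  (atoms S `|` sumset (atoms S) (atoms S)) (h + k).
Proof.
move=> Sh Sk Shk.
have : sumset (gaps S) (gaps S) (h + k) by exists h => //; exists k.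
by move=> /hgap.1[[//|]|]; [left | right].
Qed.

Lemma sumset_atoms_sub x : (atoms S `|` sumset (atoms S) (atoms S)) x -> S x.
Proof.
case=> [/atoms_sub //|[a /atoms_sub Sa [b /atoms_sub Sb <-]]].
exact: hS.2.
Qed.

Lemma factorizations_in s u : factorizations S s u -> S s.
Proof.
elim: {u}(mlength u) {-2}u (erefl (mlength u)) s => [|n IH] u ul s uS.
  move: uS; have /eqP -> : u == mset0 by rewrite -size_mset_eq0 -mlengthE ul.
  by case=> _; rewrite mvalue_mset0 => <-; exact: hS.1.
have [a [u' uE]] : exists a u', u = (a +` u')%mset by apply: mlength_gt0P; rewrite ul.
move: uS ul; rewrite uE => /factorizations_uncons[t [Aa -> tS]].
rewrite mlength_cons => -[ul]; apply: hS.2; [exact: atoms_sub | exact: IH tS].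
Qed.

Lemma atom_add_mem a h : atoms S a -> S (a + h).
Proof.
move=> Aa; have [Sh|nSh] := pselect (S h).
  by apply: hS.2 => //; exact: atoms_sub.
by rewrite addrC; apply/sumset_atoms_sub/gap_add_atom.
Qed.

Lemma atom_dvd x : S x -> x <> 0 -> exists a t : N2, atoms S a /\ x = a + t.
Proof.
move=> Sx x0; have [u uS] := factorization_ex Sx.
have [|a [u' uE]] := @mlength_gt0P u.
  rewrite lt0n mlengthE size_mset_eq0; apply/eqP => u0; apply: x0.
  by case: uS => _ <-; rewrite u0 mvalue_mset0.
by move: uS; rewrite uE => /factorizations_uncons[t [Aa xE _]]; exists a, t.
Qed.

(** Write [x = a + t] with [a] an atom: [a] absorbs the arbitrary vector [t + h]. *)
Lemma nonzero_add_mem x h : S x -> x <> 0 -> S (x + h).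
Proof.
by move=> Sx x0; have [a [t [Aa ->]]] := atom_dvd Sx x0; rewrite -addrA; exact: atom_add_mem.
Qed.

(** A splitting [g = x + y] would give [b = x + (y + d)], where [y + d] stays in [S] by the up-set
    property, contradicting that [b] is an atom. *)
Lemma atom_summand b d g : atoms S b -> b = d + g -> S g -> g <> 0 -> atoms S g.
Proof.
move=> [_ nb] bE Sg g0; split => // -[x [Sx x0] [y [Sy y0] xy]].
apply: nb; exists x => //; exists (y + d).
  split; first exact: nonzero_add_mem.
  move=> /= yd; have := size_N2_gt0 y0.
  by have := size_N2D y d; rewrite yd => /esym/eqP; rewrite addn_eq0 => /andP[/eqP ->].
by rewrite addrA xy addrC -bE.
Qed.

Lemma atom_summand_gap b d g : atoms S b -> b = d + g -> S g -> g <> 0 -> d <> 0 -> ~ S d.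
Proof. by move=> [_ nb] bE Sg g0 d0 Sd; apply: nb; rewrite bE; exists d => //; exists g. Qed.

Lemma factorizations_mem s u a : factorizations S s u -> a \in u ->
  exists t : N2, [/\ atoms S a, s = a + t, S t & factorizations S t (u `\ a)%mset].
Proof.
move=> uS au; move: uS; rewrite -{1}(msetB1K au) => /factorizations_uncons[t [Aa st tS]].
by exists t; split=> //; exact: factorizations_in tS.
Qed.

(** Pick three atoms of [u]. In each coordinate at most one of them exceeds half of [s], so the two
    coordinates rule out at most two of the three. *)
Lemma factorization_half s u : factorizations S s u -> (2 < mlength u)%N ->
  exists a : N2, [/\ a \in u, (a.1 + a.1 <= s.1)%N & (a.2 + a.2 <= s.2)%N].
Proof.
move=> uS ul; have [a [u1 E1]] := mlength_gt0P (ltn_trans (ltn0Sn 1) ul).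
move: uS ul; rewrite E1 mlength_cons ltnS => uS ul.
have [b [u2 E2]] := mlength_gt0P (ltn_trans (ltn0Sn 0) ul).
move: uS ul; rewrite E2 mlength_cons ltnS => uS /mlength_gt0P[c [u3 E3]].
move: uS; rewrite E3 => -[_]; rewrite !mvalue_cons => <-.
have au : a \in (a +` (b +` (c +` u3)))%mset by rewrite !in_mset1D eqxx.
have bu : b \in (a +` (b +` (c +` u3)))%mset by rewrite !in_mset1D eqxx !orbT.
have cu : c \in (a +` (b +` (c +` u3)))%mset by rewrite !in_mset1D eqxx !orbT.
case: (mvalue u3) => r1 r2.
have [aP|] := boolP ((a.1 + a.1 <= a.1 + (b.1 + (c.1 + r1)))%N
  && (a.2 + a.2 <= a.2 + (b.2 + (c.2 + r2)))%N).
  by exists a; case/andP: aP.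
have [bP|] := boolP ((b.1 + b.1 <= a.1 + (b.1 + (c.1 + r1)))%N
  && (b.2 + b.2 <= a.2 + (b.2 + (c.2 + r2)))%N).
  by exists b; case/andP: bP.
have [cP|] := boolP ((c.1 + c.1 <= a.1 + (b.1 + (c.1 + r1)))%N
  && (c.2 + c.2 <= a.2 + (b.2 + (c.2 + r2)))%N).
  by exists c; case/andP: cP.
lia.
Qed.

(** * The inductive step: joining factorizations of [s], given the bound 3 for all sizes below
    [n] *)

Section Descent.
Variables (n : nat) (s : N2).
Hypotheses (sn : (size_N2 s <= n)%N)
  (IH : forall t u v, (size_N2 t < n)%N ->
    factorizations S t u -> factorizations S t v -> chain_joined S t 3 u v).

(** Cancelling [a] strictly lowers the size, since atoms are nonzero; the chain supplied by [IH] is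
    then translated back by [a]. *)
Lemma chain_joined_common (a : N2) u v : factorizations S s u -> factorizations S s v ->
  a \in u -> a \in v -> chain_joined S s 3 u v.
Proof.
move=> uS vS au av.
have [t [Aa st St tu]] := factorizations_mem uS au.
have [t' [_ st' _ tv]] := factorizations_mem vS av.
have tt' : t = t' by apply: (@N2_addI a); rewrite -st.
rewrite -(msetB1K au) -(msetB1K av) st; apply: chain_joined_cons => //.
apply: IH => //; last by rewrite tt'.
apply: leq_trans sn; rewrite st size_N2D -[X in (X < _)%N]add0n ltn_add2r.
by apply: size_N2_gt0; case: Aa => -[].
Qed.

Lemma chain_joined_link (a b h : N2) u v : factorizations S s u -> factorizations S s v ->
  a \in u -> b \in v -> s = a + (b + h) -> chain_joined S s 3 u v.
Proof.
move=> uS vS au bv sE.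
have [_ [Aa _ _ _]] := factorizations_mem uS au.
have [_ [Ab _ _ _]] := factorizations_mem vS bv.
have [Sh|nSh] := pselect (S h).
  have [w wS] := factorization_ex Sh.
  have WS : factorizations S s (a +` (b +` w))%mset.
    by rewrite sE; do 2![apply: factorizations_cons => //].
  apply: (@chain_joined_trans _ _ _ _ (a +` (b +` w))%mset).
    by apply: (@chain_joined_common a) => //; rewrite mset1D1.
  by apply: (@chain_joined_common b) => //; rewrite mset1Dr // mset1D1.
have [w wS wl] := short_factorization (gap_add_atom nSh Aa).
have [x xS xl] := short_factorization (gap_add_atom nSh Ab).
have WS : factorizations S s (b +` w)%mset.
  by rewrite sE addrCA [a + h]addrC; exact: factorizations_cons.
have XS : factorizations S s (a +` x)%mset.
  by rewrite sE [b + h]addrC; exact: factorizations_cons.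
apply: (@chain_joined_trans _ _ _ _ (a +` x)%mset).
  by apply: (@chain_joined_common a) => //; rewrite mset1D1.
apply: (@chain_joined_trans _ _ _ _ (b +` w)%mset).
  by apply: chain_joined_short; rewrite // mlength_cons.
by apply: (@chain_joined_common b) => //; rewrite mset1D1.
Qed.

(** The remainder [d] is a gap because [b] is an atom, so [d + b'] has a factorization [w] of length
    at most 2. Then [g] followed by [w] is linked to [u] through [a + g], and to [v] because both
    are short. *)
Lemma chain_joined_summand (a b b' d g k : N2) u v :
  factorizations S s u -> factorizations S s v -> (mlength v <= 3)%N ->
  a \in u -> atoms S b -> atoms S b' -> s = b + b' ->
  b = d + g -> d <> 0 -> S g -> g <> 0 -> s = a + (g + k) ->
  chain_joined S s 3 u v.
Proof.
move=> uS vS vl au Ab Ab' sE bE d0 Sg g0 sE'.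
have Ag := atom_summand Ab bE Sg g0.
have nSd := atom_summand_gap Ab bE Sg g0 d0.
have [w wS wl] := short_factorization (gap_add_atom nSd Ab').
have WS : factorizations S s (g +` w)%mset.
  by rewrite sE bE -addrA addrCA; exact: factorizations_cons.
apply: (@chain_joined_trans _ _ _ _ (g +` w)%mset).
  by apply: (@chain_joined_link a g k) => //; rewrite mset1D1.
by apply: chain_joined_short; rewrite // mlength_cons.
Qed.

Lemma chain_joined_two (a b b' : N2) u v :
  factorizations S s u -> factorizations S s v -> (mlength v <= 3)%N ->
  a \in u -> atoms S b -> atoms S b' -> s = b + b' ->
  (0 < a.1 <= b.1)%N -> (0 < a.2 <= b'.2)%N ->
  chain_joined S s 3 u v.
Proof.
move=> uS vS vl au Ab Ab' sE /andP[a1 ab] /andP[a2 ab'].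
(* The vector [a] is cut into its two axis components, one subtracted from [b] and the other from
   [b']. *)
pose g : N2 := (b.1 - a.1, b.2)%N; pose g' : N2 := (b'.1, b'.2 - a.2)%N.
have bE : b = (a.1, 0%N) + g.
  by rewrite /g; case: (b) ab => x y /= ab; congr pair; rewrite /= ?add0n //; apply/esym/subnKC.
have bE' : b' = (0%N, a.2) + g'.
  by rewrite /g'; case: (b') ab' => x y /= ab'; congr pair; rewrite /= ?add0n //; apply/esym/subnKC.
have aE : a = (a.1, 0%N) + (0%N, a.2).
  by case: (a) => x y /=; congr pair; exact/esym/addn0.
have sg : s = a + (g + g') by rewrite sE {1}bE {1}bE' addrACA -aE.
have [t [Aa st St _]] := factorizations_mem uS au.
have Sgg : S (g + g').
  by have -> : g + g' = t by apply: (@N2_addI a); rewrite -sg.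
have a10 : ((a.1, 0%N) : N2) <> 0 by case=> a10; rewrite a10 in a1.
have a20 : ((0%N, a.2) : N2) <> 0 by case=> a20; rewrite a20 in a2.
have [[Sg g0]|ng] := pselect (nonzero S g).
  exact: (chain_joined_summand uS vS vl au Ab Ab' sE bE a10 Sg g0 sg).
have [[Sg' g0']|ng'] := pselect (nonzero S g').
  apply: (chain_joined_summand (k := g) uS vS vl au Ab' Ab _ bE' a20 Sg' g0').
    by rewrite sE addrC.
  by rewrite sg [g' + g]addrC.
(* Otherwise [a = s = b + b'] would not be an atom. *)
have gg0 : g + g' <> 0.
  move=> gg0; case: Aa => _; apply.
  have -> : a = b + b' by rewrite -sE sg gg0 addr0.
  by case: Ab => Sb _; case: Ab' => Sb' _; exists b => //; exists b'.
(* Once [g] is not in [S^*], membership in [S] forces [g = 0]; then [g' = g + g'] is a nonzero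
   element of [S], a case already settled. *)
have nSg : ~ S g.
  move=> Sg; have g0 : g = 0 by apply: contrapT => g0; apply: ng.
  by move: Sgg gg0; rewrite g0 add0r => ? ?; apply: ng'.
have nSg' : ~ S g'.
  move=> Sg'; have g0 : g' = 0 by apply: contrapT => g0; apply: ng'.
  by move: Sgg gg0; rewrite g0 addr0 => ? ?; apply: ng.
have [w wS wl] := short_factorization (gap_add_gap nSg nSg' Sgg).
have WS : factorizations S s (a +` w)%mset by rewrite sg; exact: factorizations_cons.
apply: (@chain_joined_trans _ _ _ _ (a +` w)%mset).
  by apply: (@chain_joined_common a) => //; rewrite mset1D1.
by apply: chain_joined_short; rewrite // mlength_cons.
Qed.

Lemma chain_joined_long u v : factorizations S s u -> factorizations S s v ->
  (2 < mlength u)%N -> chain_joined S s 3 u v.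
Proof.
move=> uS vS ul.
have [a [au a1 a2]] := factorization_half uS ul.
have [t [Aa st St tu]] := factorizations_mem uS au.
have link (b : N2) : b \in v -> (a.1 + b.1 <= s.1)%N -> (a.2 + b.2 <= s.2)%N ->
    chain_joined S s 3 u v.
  move=> bv ab1 ab2; have [h sE] := @N2_le_add (a + b) s ab1 ab2.
  by apply: (@chain_joined_link a b h) => //; rewrite addrA.
have [vl|vl] := ltnP 2 (mlength v).
  have [b [bv b1 b2]] := factorization_half vS vl.
  (* Both [a] and [b] are at most half of [s] in each coordinate, hence [a + b <= s]. *)
  by apply: (link b) => //; lia.
have s0 : s <> 0.
  move=> s0; have : a <> 0 by case: Aa => -[].
  by move/size_N2_gt0; rewrite /size_N2; move: a1 a2; rewrite s0 /=; lia.
(* If [t] were zero, then [s = a] and [2a <= s] would force [a = 0]. Hence [v] cannot be a single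
   atom and consists of exactly [b] and [b']. *)
have nAs : ~ atoms S s.
  case=> _; apply; rewrite st.
  exists a; first by case: Aa.
  exists t => //; split=> // t0; move: ul.
  have : a <> 0 by case: Aa => -[].
  move/size_N2_gt0; move: a1 a2; rewrite st t0 addr0 /size_N2; lia.
have vlpos : (0 < mlength v)%N.
  rewrite lt0n mlengthE size_mset_eq0; apply/eqP => v0; apply: s0.
  by case: vS => _ <-; rewrite v0 mvalue_mset0.
have [b [v' vE]] := mlength_gt0P vlpos.
have [|t' [Ab sE t'S]] := @factorizations_uncons S s b v'; first by rewrite -vE.
have vlpos' : (0 < mlength v')%N.
  rewrite lt0n mlengthE size_mset_eq0; apply/eqP => v0; apply: nAs.
  by case: t'S sE => _ <-; rewrite v0 mvalue_mset0 addr0 => ->.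
have [b' [v2 v2E]] := mlength_gt0P vlpos'.
move: t'S; rewrite v2E => /factorizations_uncons[t2 [Ab' t'E t2S]].
have v20 : v2 = mset0.
  by apply/eqP; rewrite -size_mset_eq0 -mlengthE; move: vl; rewrite vE v2E !mlength_cons; case: mlength.
have sE' : s = b + b'.
  by rewrite sE t'E; case: t2S => _ <-; rewrite v20 mvalue_mset0 addr0.
have bv : b \in v by rewrite vE mset1D1.
have bv' : b' \in v by rewrite vE v2E mset1Dr // mset1D1.
have s1 : s.1 = (b.1 + b'.1)%N by rewrite sE'.
have s2 : s.2 = (b.2 + b'.2)%N by rewrite sE'.
have [/andP[]|nb] := boolP ((a.1 + b.1 <= s.1)%N && (a.2 + b.2 <= s.2)%N); first exact: link.
have [/andP[]|nb'] := boolP ((a.1 + b'.1 <= s.1)%N && (a.2 + b'.2 <= s.2)%N); first exact: link.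
(* Here [a] exceeds [b'] in some coordinate and [b] in some coordinate. By [2a <= s] these
   coordinates differ, and comparing [a.1] with [b.1] tells which is which; the strict excesses make
   both coordinates of [a] positive. *)
have [ab|ab] := leqP a.1 b.1.
  by apply: (@chain_joined_two a b b') => //; lia.
apply: (@chain_joined_two a b' b) => //; [lia| by rewrite sE' addrC|lia|lia].
Qed.

End Descent.

(** * Closing the induction and bounding the catenary degree *)

Lemma factorizations_chain_joined s u v :
  factorizations S s u -> factorizations S s v -> chain_joined S s 3 u v.
Proof.
suff H n : forall t x y, (size_N2 t < n)%N ->
    factorizations S t x -> factorizations S t y -> chain_joined S t 3 x y.
  exact: H (ltnSn _).
elim: n => // n IH t x y tn xS yS; rewrite ltnS in tn.
have [xl|xl] := ltnP 2 (mlength x); first exact: (chain_joined_long tn IH).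
have [yl|yl] := ltnP 2 (mlength y).
  exact/chain_joined_sym/(chain_joined_long tn IH).
by apply: chain_joined_short => //; exact: leqW.
Qed.

End GapAbsorbing.

Theorem mainTheorem15 (R : realType) (S : set (nat * nat))
    (hS : submonoid S) (hgap : gap_absorbing S) :
  (catenary_degree R S <= 3%:R%:E)%E.
Proof.
apply: ge_ereal_sup => _ [s _ <-]; rewrite lee_fin ler_nat /catenary_degree_elt.
(* By minimality of [m], it suffices that 3 itself is a chain bound for [s]. *)
case: ex_minnP => m _; apply; apply/asboolP; split=> // u v.
exact: factorizations_chain_joined.
Qed.
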